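(* Let $G$ be a finite simple graph such that no connected component of $G$ is a complete graph. Then $\gamma_{\rm gr}^{\rm Z}(G) \ge \gamma_t(G)$.
   Context: For a vertex $v$, $N(v)$ is its open neighborhood and $N[v]=N(v)\cup\{v\}$ its closed neighborhood. A set $D\subseteq V(G)$ is a total dominating set (TD-set) if every vertex of $G$ has a neighbor in $D$; $\gamma_t(G)$ is the minimum cardinality of a TD-set. A sequence $(v_1,\ldots,v_k)$ of distinct vertices of $G$ is a Z-sequence if for every $i\in\{1,\ldots,k\}$, $N(v_i)\setminus\bigcup_{j=1}^{i-1}N[v_j]\neq\emptyset$ (for $i=1$ this means $v_1$ has a neighbor). The Z-Grundy domination number $\gamma_{\rm gr}^{\rm Z}(G)$ is the maximum length of a Z-sequence in $G$. *)

(* Defs.v *)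
From mathcomp Require Export all_boot.

Set Implicit Arguments.
Unset Strict Implicit.
Unset Printing Implicit Defensive.

(* A finite simple graph is a symmetric irreflexive relation [e] on a finType. *)
Section Graph.
Variables (T : finType) (e : rel T).

Definition nbhd (v : T) : {set T} := [set u | e v u].

Definition cnbhd (v : T) : {set T} := v |: nbhd v.

Definition components : {set {set T}} :=
  equivalence_partition (connect e) [set: T].

(* The subgraph induced on [C] is complete; in particular, so is the subgraph
   induced on a single vertex. *)
Definition complete_on (C : {set T}) : bool :=
  [forall u in C, forall v in C, (u != v) ==> e u v].

Definition td_set (D : {set T}) : bool :=
  [forall v, exists u in D, u \in nbhd v].

(* If some set is a TD-set then so is [setT], hence the value below is the
   minimum over all TD-sets whenever the graph has no isolated vertex; in a
   graph with isolated vertices it is meaningless. *)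
Definition gamma_t : nat :=
  #|[arg min_(D < [set: T] | td_set D) #|D| ]|.

Definition Z_sequence (k : nat) (s : k.-tuple T) : bool :=
  uniq s &&
  [forall i : 'I_k,
     nbhd (tnth s i) :\: \bigcup_(j < k | j < i) cnbhd (tnth s j) != set0].

(* Vertices of a Z-sequence are distinct, so its length is at most [#|T|].
   The empty sequence is a Z-sequence. *)
Definition gamma_grZ : nat :=
  \max_(k < #|T|.+1 | [exists s : k.-tuple T, Z_sequence s]) k.

Lemma gamma_tP :
  (forall v, nbhd v != set0) ->
  (exists2 D, td_set D & #|D| = gamma_t) /\
  (forall D, td_set D -> gamma_t <= #|D|).
Proof.
move=> noiso; have tdT : td_set [set: T].
  apply/forallP=> v; have /set0Pn[u uv] := noiso v.
  by apply/existsP; exists u; rewrite inE.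
by rewrite /gamma_t; case: arg_minnP => // D tdD minD; split=> //; exists D.
Qed.

Lemma gamma_grZP :
  (exists s : gamma_grZ.-tuple T, Z_sequence s) /\
  (forall k (s : k.-tuple T), Z_sequence s -> k <= gamma_grZ).
Proof.
split; last first.
  move=> k s Zs; have ltk : k < #|T|.+1.
    have /andP[us _] := Zs.
    by rewrite ltnS -(size_tuple s) -(card_uniqP us) max_card.
  apply: (@leq_bigmax_cond _ _ (fun k : 'I_#|T|.+1 => k : nat) (Ordinal ltk)).
  by apply/existsP; exists s.
pose P (k : 'I_#|T|.+1) := [exists s : k.-tuple T, Z_sequence s].
have P0 : P ord0.
  by apply/existsP; exists [tuple]; apply/forallP=> -[].
rewrite /gamma_grZ -/P (@bigmax_eq_arg _ ord0 P (fun k => k : nat) P0).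
by case: arg_maxnP => // k /existsP[s Zs] _; exists s.
Qed.

End Graph.

(* Main.v *)
Require Import Defs.

(** Choose a minimum TD-set [D] inducing as many edges as possible.  By
    minimality every [d] in [D] is the only [D]-neighbour of some vertex.
    Listing [D] with the vertices lacking such a neighbour outside [D] first
    gives a Z-sequence, except when [G[D]] has an isolated edge [vw] neither end
    of which has a private neighbour outside [D].  For such an edge, swapping [w]
    with a neighbour [x] of [v] yields another minimum TD-set, so by the choice
    of [D] all vertices of [N(v) \ D] see exactly [v] and [w] in [D]; thus
    [N[v] = N[w]], and for distinct such edges there is no edge between these
    neighbourhoods.  As [N[v]] is not a complete component, it contains distinct
    nonadjacent [x] and [y]; replacing [w] by [x] and playing [x] (footprinting
    [w]) and [v] (footprinting [y]) at the end repairs the sequence. *)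

Set Implicit Arguments.
Unset Strict Implicit.
Unset Printing Implicit Defensive.

Section ZGrundy.
Variables (T : finType) (e : rel T).

(** * Z-sequences from ranked footprints *)

(* Distinctness of the [g d] need not be assumed: [g d = g d'] would force both
   [r d < r d'] and [r d' < r d]. *)
Lemma Z_sequence_of_rank (D : {set T}) (g f : T -> T) (r : T -> nat) :
  {in D, forall d, e (g d) (f d)} ->
  {in D &, forall d d', d != d' -> f d \in cnbhd e (g d') -> r d < r d'} ->
  #|D| <= gamma_grZ e.
Proof.
move=> gf conf.
pose leT := [rel a b | r a <= r b].
pose s := sort leT (enum D).
have leT_tr : transitive leT by move=> b a c /=; apply: leq_trans.
have s_sorted : sorted leT s by apply: sort_sorted => a b; apply: leq_total.
have us : uniq s by rewrite sort_uniq enum_uniq.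
have sD d : (d \in s) = (d \in D) by rewrite mem_sort mem_enum.
have szs : size s = #|D| by rewrite size_sort -cardE.
have [d0 d0D|D0] := pickP (mem D); last by rewrite eq_card0.
have g_inj : {in s &, injective g}.
  move=> a b; rewrite !sD => aD bD gab; apply/eqP/negPn/negP => ab.
  have fg c : c \in D -> f c \in cnbhd e (g c).
    by move=> cD; rewrite !inE gf ?orbT.
  have := conf a b aD bD ab; rewrite -gab fg // => /(_ isT) lt_ab.
  have := conf b a bD aD; rewrite eq_sym gab fg // => /(_ ab isT).
  by rewrite ltnNge ltnW.
have [_ maxZ] := gamma_grZP e.
have szt : size (map g s) == #|D| by rewrite size_map szs.
apply: (maxZ _ (Tuple szt)); apply/andP; split; first by rewrite map_inj_in_uniq.
apply/forallP => i; apply/set0Pn.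
have nthD (k : 'I_#|D|) : nth d0 s k \in D by rewrite -sD mem_nth ?szs.
have tnthE (k : 'I_#|D|) : tnth (Tuple szt) k = g (nth d0 s k).
  by rewrite (tnth_nth (g d0)) /= (nth_map d0) ?szs.
exists (f (nth d0 s i)); rewrite inE tnthE inE gf ?nthD // andbT.
(* Sorting bounds the rank of an earlier entry by the current one, whereas [conf] would make it
   strictly larger; the order among ties is therefore harmless. *)
apply/bigcupP => -[j lt_ji]; rewrite tnthE => /conf.
rewrite !nthD nth_uniq ?szs // neq_ltn lt_ji orbT => /(_ isT isT isT).
rewrite ltnNge => /negP; apply.
by apply: (sorted_ltn_nth leT_tr) => //; rewrite inE szs.
Qed.

(** * Edge counts and private neighbours *)

Hypotheses (e_sym : symmetric e) (e_irr : irreflexive e).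

(** Twice the number of edges of [G[D]]: each edge is counted from both ends. *)
Definition edges (D : {set T}) : nat := \sum_(u in D) #|nbhd e u :&: D|.

Lemma edgesU1 (x : T) (D : {set T}) :
  x \notin D -> edges (x |: D) = edges D + #|nbhd e x :&: D|.*2.
Proof.
move=> xD; rewrite /edges big_setU1 //=.
have -> : nbhd e x :&: (x |: D) = nbhd e x :&: D.
  by apply/setP => u; rewrite !inE; case: eqVneq => [->|//]; rewrite e_irr.
rewrite -addnn addnA addnC; congr (_ + _).
rewrite -[in RHS]sum1_card [X in _ = _ + X](eq_bigl (fun u => (u \in D) && e x u)).
  rewrite [X in _ = _ + X]big_mkcondr -big_split /=; apply: eq_bigr => u uD.
  have -> : nbhd e u :&: (x |: D) =
      if e x u then x |: (nbhd e u :&: D) else nbhd e u :&: D.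
    apply/setP => z; rewrite e_sym; case: ifP => eux; rewrite !inE.
      by case: eqVneq => [->|//]; rewrite eux.
    by case: eqVneq => [->|//]; rewrite eux.
  by case: ifP => _; rewrite ?addn0 // cardsU1 !inE (negPf xD) andbF addnC.
by move=> u; rewrite !inE andbC.
Qed.

(** Such an [x] is a private neighbour of [d] and may itself lie in [D]; [has_epn] asks for an
    external one. *)
Definition sole (D : {set T}) (d x : T) : bool := nbhd e x :&: D == [set d].

Definition has_epn (D : {set T}) (d : T) : bool :=
  [exists x, (x \notin D) && sole D d x].

(* [vw] is a component of [G[D]] that cannot be played as it stands. *)
Definition bad (D : {set T}) (v w : T) : bool :=
  [&& sole D w v, sole D v w, ~~ has_epn D v & ~~ has_epn D w].

Lemma soleP (D : {set T}) (d x : T) :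
  reflect [/\ d \in D, e x d & {in D, forall u, e x u -> u = d}] (sole D d x).
Proof.
apply: (iffP eqP) => [E|[dD exd uniq_d]].
  have : d \in nbhd e x :&: D by rewrite E set11.
  rewrite !inE => /andP[exd dD]; split=> // u uD exu.
  by apply/set1P; rewrite -E !inE exu uD.
apply/setP => u; rewrite !inE; apply/andP/eqP => [[exu uD]|->//].
exact: uniq_d.
Qed.

Lemma badC (D : {set T}) (v w : T) : bad D v w -> bad D w v.
Proof. by case/and4P => *; apply/and4P. Qed.

Lemma no_epn_nbr (D : {set T}) (d x : T) :
  ~~ has_epn D d -> d \in D -> x \notin D -> e d x ->
  exists u, [/\ u \in D, e x u & u != d].
Proof.
move=> no_epn dD xD edx.
have [/existsP[u /and3P[]]|/existsPn none] :=
  boolP [exists u, [&& u \in D, e x u & u != d]]; first by exists u.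
case/negP: no_epn; apply/existsP; exists x; rewrite xD; apply/soleP; split=> //.
  by rewrite e_sym.
move=> u uD exu; apply/eqP; move: (none u).
by rewrite uD exu /= negbK.
Qed.

(** * Exchanges in optimal total dominating sets *)

Definition optimal (D : {set T}) : Prop :=
  td_set e D /\ forall D', td_set e D' ->
    #|D| <= #|D'| /\ (#|D'| = #|D| -> edges D' <= edges D).

Lemma td_setP (D : {set T}) :
  reflect (forall v, exists2 u, u \in D & e v u) (td_set e D).
Proof.
apply: (iffP forallP) => H v; have := H v.
  by case/existsP => u /andP[uD]; rewrite inE; exists u.
by case=> u uD evu; apply/existsP; exists u; rewrite uD inE.
Qed.

Lemma exists_optimal : (forall v, nbhd e v != set0) -> exists D, optimal D.
Proof.
move=> noiso; have [[D1 tdD1 cardD1] minD] := gamma_tP noiso.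
pose P D := td_set e D && (#|D| == gamma_t e).
have PD1 : P D1 by rewrite /P tdD1 cardD1 eqxx.
have [D /andP[tdD /eqP cD] maxD] := arg_maxnP edges PD1.
exists D; split=> // D' tdD'; split; first by rewrite cD minD.
by move=> cD'; apply: maxD; rewrite /P tdD' cD' cD eqxx.
Qed.

Section Optimal.
Variables (D : {set T}) (optD : optimal D).

(** Otherwise [D :\ d] would be a smaller TD-set. *)
Lemma optimal_sole (d : T) : d \in D -> exists x, sole D d x.
Proof.
move=> dD; have [/td_setP tdD minD] := optD.
have [/existsP//|/existsPn none] := boolP [exists x, sole D d x].
have [|le_D _] := minD (D :\ d); last by move: le_D; rewrite (cardsD1 d D) dD ltnn.
apply/td_setP => x; have [u uD exu] := tdD x.
have [ud|nud] := eqVneq u d; last by exists u; rewrite // !inE nud.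
have [/existsP[z /and3P[zD exz zd]]|/existsPn allz] :=
  boolP [exists z, [&& z \in D, e x z & z != d]].
  by exists z; rewrite // !inE zd.
case/negP: (none x); apply/soleP; split=> //; first by rewrite -ud.
move=> z zD exz; apply/eqP; move: (allz z).
by rewrite zD exz /= negbK.
Qed.

(** Only neighbours of [w] are at risk: [v] is now dominated by [x], and the others lie outside [D]
    and, not being private to [w], have another neighbour in [D]. *)
Lemma bad_swap_td (v w x : T) :
  bad D v w -> x \notin D -> e v x -> td_set e (x |: D :\ w).
Proof.
case/and4P => /soleP[wD evw uniq_v] /soleP[vD ewv uniq_w] nv nw xD evx.
have [/td_setP tdD _] := optD; apply/td_setP => z; have [u uD ezu] := tdD z.
have [uw|nuw] := eqVneq u w; last by exists u; rewrite // !inE uD nuw orbT.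
rewrite {}uw {uD} in ezu.
have [->|zv] := eqVneq z v; first by exists x; rewrite // setU11.
have zD : z \notin D.
  by apply/negP => zD; case/eqP: zv; apply: uniq_w; rewrite // e_sym.
rewrite e_sym in ezu.
have [t [tD ezt tw]] := no_epn_nbr nw wD zD ezu.
by exists t; rewrite // !inE tD tw orbT.
Qed.

Lemma bad_swap_card (v w x : T) :
  bad D v w -> x \notin D -> #|x |: D :\ w| = #|D|.
Proof.
case/and4P => /soleP[wD _ _] _ _ _ xD.
by rewrite cardsU1 !inE (negPf xD) andbF (cardsD1 w D) wD.
Qed.

(** Removing [w] destroys only the edge [vw], which [edges] counts twice; the 2 stands on the left
    to avoid subtraction. *)
Lemma bad_swap_edges (v w x : T) : bad D v w -> x \notin D ->
  edges (x |: D :\ w) + 2 = edges D + #|nbhd e x :&: (D :\ w)|.*2.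
Proof.
case/and4P => /soleP[wD evw _] /soleP[vD ewv uniq_w] _ _ xD.
have vw : v != w by apply: contraTneq evw => ->; rewrite e_irr.
rewrite edgesU1 ?inE ?negb_and ?xD ?orbT // -[X in _ = edges X + _](setD1K wD).
rewrite edgesU1 ?setD11 //.
have -> : nbhd e w :&: (D :\ w) = [set v].
  apply/setP => u; rewrite !inE; apply/and3P/eqP => [[ewu _ uD]|->//].
  exact: uniq_w.
by rewrite cards1 addnAC.
Qed.

(** Maximality of [edges D] leaves [x] at most one neighbour in [D :\ w], namely [v]. Since [x] is
    not private to [v], it must also see [w]. *)
Lemma bad_nbr (v w x : T) : bad D v w -> x \notin D -> e v x ->
  e w x /\ {in D, forall u, e x u -> u = v \/ u = w}.
Proof.
move=> bvw xD evx; have [_ /(_ _ (bad_swap_td bvw xD evx)) [_]] := optD.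
move/(_ (bad_swap_card bvw xD)); rewrite -(leq_add2r 2) (bad_swap_edges bvw xD).
rewrite leq_add2l -[2]/(1.*2) leq_double => card_le1.
case/and4P: (bvw) => /soleP[wD evw _] /soleP[vD ewv _] nv _.
have vw : v != w by apply: contraTneq evw => ->; rewrite e_irr.
have nbr u : u \in D -> e x u -> u = v \/ u = w.
  move=> uD exu; have [|uw] := eqVneq u w; [by right | left].
  apply: (card_le1_eqP card_le1); rewrite !inE ?uw ?exu //.
  by rewrite vw vD e_sym evx.
split=> //; have [u [uD exu uv]] := no_epn_nbr nv vD xD evx.
by case: (nbr u uD exu) => uE; rewrite uE ?eqxx // e_sym in uv exu *.
Qed.

(** By [bad_nbr] the swap trades the edge [vw] for the single edge [vx]. *)
Lemma bad_swap_optimal (v w x : T) :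
  bad D v w -> x \notin D -> e v x -> optimal (x |: D :\ w).
Proof.
move=> bvw xD evx; split; first exact: bad_swap_td evx.
have edgesE : edges (x |: D :\ w) = edges D.
  apply/eqP; rewrite -(eqn_add2r 2) (bad_swap_edges bvw xD) eqn_add2l.
  rewrite -[2]/(1.*2) -(cards1 v); apply/eqP; congr (#|pred_of_set _|.*2).
  have [_ nbr] := bad_nbr bvw xD evx.
  case/and4P: bvw => /soleP[wD evw _] /soleP[vD _ _] _ _.
  apply/setP => u; rewrite !inE; apply/and3P/eqP => [[exu uw uD]|->].
    by have [//|uE] := nbr u uD exu; rewrite uE eqxx in uw.
  rewrite e_sym evx vD; split=> //.
  by apply: contraTneq evw => ->; rewrite e_irr.
by rewrite (bad_swap_card bvw xD) edgesE; case: optD.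
Qed.

End Optimal.

(* An edge [yx] would make the optimal set [y |: D :\ w] violate [bad_nbr]. *)
Lemma bad_no_edge (D : {set T}) (v w y v' w' x : T) :
  optimal D -> bad D v w -> bad D v' w' -> v' != v -> v' != w ->
  y \notin D -> e v y -> x \notin D -> e v' x -> ~~ e y x.
Proof.
move=> optD bvw bvw' v'v v'w yD evy xD evx'; apply/negP => eyx.
case/and4P: (bvw) => /soleP[wD evw uniq_v] /soleP[vD _ uniq_w] _ _.
case/and4P: (bvw') => /soleP[wD' evw' uniq_v'] /soleP[vD' ewv' uniq_w'] nv' nw'.
have [_ nbr_y] := bad_nbr optD bvw yD evy.
have w'v : w' != v.
  apply: contraNneq v'w => w'v; apply/eqP; apply: uniq_v => //.
  by rewrite -w'v.
have w'w : w' != w.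
  apply: contraNneq v'v => w'w; apply/eqP; apply: uniq_w => //.
  by rewrite -w'w.
have not_y u : u \in D -> u != v -> u != w -> ~~ e u y.
  move=> uD uv uw; apply/negP; rewrite e_sym => /(nbr_y u uD).
  by case=> uE; rewrite uE eqxx in uv uw.
have swap_sole a b : a \in D -> b \in D -> a != v -> a != w -> b != w ->
    e b a -> {in D, forall u, e b u -> u = a} -> b != v ->
    sole (y |: D :\ w) a b.
  move=> aD bD av aw bw eba uniq_b bv; apply/soleP; split=> //.
    by rewrite !inE aD aw orbT.
  move=> u; rewrite !inE => /orP[/eqP ->|/andP[_ uD] ebu]; last exact: uniq_b.
  by rewrite (negPf (not_y _ _ _ _)).
(* A private neighbour [z] of [a] would be either [w], which sees only [v] in [D], or outside [D],
   where [bad_nbr] makes it see [b] too. *)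
have swap_no_epn a b : bad D a b -> a != v -> a != w -> b != w ->
    ~~ has_epn (y |: D :\ w) a.
  move=> bab av aw bw; case/and4P: (bab) => /soleP[bD eab uniq_a] /soleP[aD eba _] na _.
  apply/negP => /existsP[z /andP[]]; rewrite !inE negb_or negb_and negbK.
  move=> /andP[zy zDw] /soleP[_ eza uniq_z].
  case/orP: zDw => [/eqP zw|zD].
    by rewrite zw in eza; rewrite (uniq_w a aD eza) eqxx in av.
  rewrite e_sym in eza; have [ebz _] := bad_nbr optD bab zD eza.
  have := uniq_z b; rewrite !inE bD bw orbT e_sym ebz => /(_ isT isT) ba.
  by rewrite ba e_irr in eab.
have bad' : bad (y |: D :\ w) v' w'.
  by apply/and4P; split;
    [apply: swap_sole | apply: swap_sole | apply: (swap_no_epn v' w')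
    | apply: (swap_no_epn w' v') => //; apply: badC].
have yx : x != y by apply: contraTneq eyx => ->; rewrite e_irr.
have xD' : x \notin y |: D :\ w by rewrite !inE negb_or yx negb_and xD orbT.
have optD' := bad_swap_optimal optD bvw yD evy.
have [_ nbr_x] := bad_nbr optD' bad' xD' evx'.
rewrite e_sym in eyx; have [yE|yE] := nbr_x y (setU11 _ _) eyx.
  by rewrite yE vD' in yD.
by rewrite yE wD' in yD.
Qed.

(** * Using the absence of complete components *)

Hypothesis no_complete_component :
  forall C : {set T}, C \in components e -> ~~ complete_on e C.

(** [A] contains the whole component of [v], which is not complete. *)
Lemma closed_not_clique (A : {set T}) (v : T) :
  v \in A -> {in A, forall a b, e a b -> b \in A} ->
  exists x y, [/\ x \in A, y \in A, x != y & ~~ e x y].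
Proof.
move=> vA clA.
have CA u : connect e v u -> u \in A.
  case/connectP => p + ->; elim: p v vA => //= b p IH a aA /andP[eab].
  by apply: IH; apply: clA eab.
have /no_complete_component : [set y in [set: T] | connect e v y] \in components e.
  by apply/imsetP; exists v; rewrite ?inE.
case/forallPn => x; rewrite negb_imply => /andP[].
rewrite !inE => /CA xA /forallPn[y]; rewrite negb_imply => /andP[].
rewrite !inE => /CA yA; rewrite negb_imply => /andP[xy exy].
by exists x, y.
Qed.

Lemma nbhd_neq0 (v : T) : nbhd e v != set0.
Proof.
apply/negP => /eqP Nv0.
have closed1 : {in [set v], forall a b, e a b -> b \in [set v]}.
  move=> a /set1P -> b evb.
  by have : b \in nbhd e v; [rewrite inE | rewrite Nv0 in_set0].
have [x [y [/set1P -> /set1P ->]]] := closed_not_clique (set11 v) closed1.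
by rewrite eqxx.
Qed.

(** Otherwise [v] and [w] would be twins and [N[v]] a clique closed under adjacency, against
    [closed_not_clique]. *)
Lemma bad_nonadjacent (D : {set T}) (v w : T) : optimal D -> bad D v w ->
  exists x y, [/\ x \notin D, y \notin D, e v x, e v y & x != y /\ ~~ e x y].
Proof.
move=> optD bvw; have bwv := badC bvw.
case/and4P: (bvw) => /soleP[wD evw uniq_v] /soleP[vD ewv uniq_w] _ _.
have [/existsP[x /existsP[y /and5P[xD yD evx evy /andP[xy exy]]]]|clique] :=
    boolP [exists x, exists y, [&& x \notin D, y \notin D, e v x, e v y
      & (x != y) && ~~ e x y]]; first by exists x, y.
have twin u : u != v -> u != w -> e v u = e w u.
  move=> uv uw; have [uD|uD] := boolP (u \in D).
    apply/idP/idP => [/(uniq_v u uD)|/(uniq_w u uD)] uE.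
      by rewrite uE eqxx in uw.
    by rewrite uE eqxx in uv.
  by apply/idP/idP => eu; [have [] := bad_nbr optD bvw uD eu
                         | have [] := bad_nbr optD bwv uD eu].
have out u : e v u -> u != w -> u \notin D.
  by move=> evu; apply: contraNN => uD; rewrite (uniq_v u uD evu).
have adj a b : a \in cnbhd e v -> b \in cnbhd e v -> a != b -> e a b.
  have half c d : c = v \/ c = w -> d \in cnbhd e v -> c != d -> e c d.
    move=> cE; rewrite !inE => /orP[/eqP ->|evd] cd; last first.
      have dv : d != v by apply: contraTneq evd => ->; rewrite e_irr.
      by case: cE cd => [->//|->] wd; rewrite -twin // eq_sym.
    by case: cE cd => ->; rewrite ?eqxx.
  move=> aA bA ab; have [av|av] := eqVneq a v; first by apply: half; auto.
  have [aw|aw] := eqVneq a w; first by apply: half; auto.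
  have [bv|bv] := eqVneq b v.
    by rewrite e_sym; apply: half; rewrite // 1?eq_sym //; left.
  have [bw|bw] := eqVneq b w.
    by rewrite e_sym; apply: half; rewrite // 1?eq_sym //; right.
  move: aA bA; rewrite !inE (negPf av) (negPf bv) /= => eva evb.
  apply: contraR clique => nab; apply/existsP; exists a; apply/existsP; exists b.
  by rewrite !out ?eva ?evb ?ab.
(* If an edge [ab] left the clique, replacing [w] by [a] would make [va] bad in an optimal set, and
   [bad_nbr] would force the edge [vb]. *)
have closed : {in cnbhd e v, forall a b, e a b -> b \in cnbhd e v}.
  move=> a aA b eab; apply/negPn/negP => bA.
  have av : a != v by apply: contraNneq bA => av; rewrite !inE -av eab orbT.
  have bv : b != v by apply: contraNneq bA => ->; rewrite !inE eqxx.
  have bw : b != w by apply: contraNneq bA => ->; rewrite !inE evw orbT.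
  have eba : e b a by rewrite e_sym.
  have nvb : ~~ e v b by apply: contraNN bA; rewrite !inE => ->; rewrite orbT.
  have aw : a != w by apply: contraNneq nvb => aw; rewrite twin // -aw.
  have eva : e v a by move: aA; rewrite !inE (negPf av).
  have aD := out a eva aw; have [_ nbr_a] := bad_nbr optD bvw aD eva.
  have bD : b \notin D.
    by apply/negP => bD; have [bE|bE] := nbr_a b bD eab; rewrite bE eqxx in bv bw.
  have vw : v != w by apply: contraTneq evw => ->; rewrite e_irr.
  have bad' : bad (a |: D :\ w) v a.
    apply/and4P; split.
    - apply/soleP; split; rewrite ?setU11 // => u.
      rewrite !inE => /orP[/eqP //|/andP[uw uD] evu].
      by rewrite (uniq_v u uD evu) eqxx in uw.
    - apply/soleP; split; rewrite ?inE ?vw ?vD ?orbT // 1?e_sym // => u.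
      rewrite !inE => /orP[/eqP ->|/andP[uw uD] eau]; first by rewrite e_irr.
      by have [//|uE] := nbr_a u uD eau; rewrite uE eqxx in uw.
    - apply/negP => /existsP[z /andP[zD' /soleP[_ ezv uniq_z]]].
      have za : z != a by apply: contraNneq zD' => ->; rewrite setU11.
      have eza : e z a by apply: adj; rewrite // !inE e_sym ezv orbT.
      by rewrite (uniq_z a (setU11 _ _) eza) eqxx in av.
    - apply/negP => /existsP[z /andP[zD' /soleP[_ eza uniq_z]]].
      (* [c] survives the swap unless it is [w], and then the twin [v] also dominates [z]. *)
      have [/td_setP/(_ z)[c cD ezc] _] := optD.
      have ca : c != a by apply: contraNneq aD => <-.
      have [cw|cw] := eqVneq c w.
        have zv : z != v.
          by apply: contraNneq zD' => ->; rewrite !inE vw vD orbT.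
        have zw : z != w by apply: contraTneq ezc => ->; rewrite cw e_irr.
        have ezv : e z v by rewrite e_sym twin // e_sym -cw.
        have := uniq_z v; rewrite !inE vw vD orbT => /(_ isT ezv) va.
        by rewrite va eqxx in av.
      have := uniq_z c; rewrite !inE cw cD orbT => /(_ isT ezc) cE.
      by rewrite cE eqxx in ca.
  have bD' : b \notin a |: D :\ w.
    rewrite !inE negb_or negb_and bD orbT andbT.
    by apply: contraTneq eab => ->; rewrite e_irr.
  have [evb _] := bad_nbr (bad_swap_optimal optD bvw aD eva) (badC bad') bD' eab.
  by rewrite evb in nvb.
have [x [y [xA yA xy /negP[]]]] := closed_not_clique (setU11 v _) closed.
exact: adj.
Qed.

(** * Assembling the Z-sequence *)

Lemma bad_uniq (D : {set T}) (v w w' : T) : bad D v w -> bad D v w' -> w' = w.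
Proof.
case/and4P => /soleP[_ _ uniq_v] _ _ _ /and4P[/soleP[wD' evw' _] _ _ _].
exact: uniq_v.
Qed.

Lemma card_optimal_le_grZ (D : {set T}) : optimal D -> #|D| <= gamma_grZ e.
Proof.
move=> optD.
pose isbad v := [exists w, bad D v w].
(* [M v] is the mate of [v] in its bad edge; at other vertices this choice, like [X] and [Y] below,
   is a dummy. *)
have /fin_all_exists[M MP] v : exists w, isbad v -> bad D v w.
  by case: (boolP (isbad v)) => [/existsP[w]|_]; [exists w | exists v].
have /fin_all_exists[X XP] v : exists x, isbad v -> exists y,
    [/\ x \notin D, y \notin D, e v x, e v y & x != y /\ ~~ e x y].
  case: (boolP (isbad v)) => [/MP/(bad_nonadjacent optD)[x] xP|_].
    by exists x.
  by exists v.
have /fin_all_exists[Y YP] v : exists y, isbad v ->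
    [/\ X v \notin D, y \notin D, e v (X v), e v y & X v != y /\ ~~ e (X v) y].
  by case: (boolP (isbad v)) => [/XP[y]|_]; [exists y | exists v].
(* An external private neighbour is preferred, so [F d] lies in [D] only if [d] has none. *)
have /fin_all_exists[F FP] d : exists x, [/\ d \in D -> sole D d x
    & d \in D -> has_epn D d -> x \notin D].
  have [dD|_] := boolP (d \in D); last by exists d.
  have [/existsP[x /andP[xD sx]]|_] := boolP (has_epn D d); first by exists x.
  by have [x sx] := optimal_sole optD dD; exists x.
have badM v : isbad v -> isbad (M v).
  by move/MP/badC => bMv; apply/existsP; exists v.
have MK v : isbad v -> M (M v) = v.
  by move=> bv; apply: bad_uniq (MP _ (badM _ bv)); apply: badC (MP _ bv).
(* The end [v] with [first v] is kept and its mate [M v] is replaced by [X v]. *)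
pose first v := enum_rank v < enum_rank (M v).
have firstM v : isbad v -> first (M v) = ~~ first v.
  move=> bv; rewrite /first MK // -leqNgt ltn_neqAle; apply: andb_idl => _.
  have /and4P[/soleP[_ evM _] _ _ _] := MP v bv.
  by apply: contraTneq evM => /val_inj/enum_rank_inj ->; rewrite e_irr.
have nbr_bad v u z : isbad v -> z \notin D -> e v z -> u \in D -> e z u ->
    u = v \/ u = M v.
  move=> bv zD evz uD ezu; have [_ nbr] := bad_nbr optD (MP v bv) zD evz.
  exact: nbr.
(* Order of play: good vertices without an external private neighbour (0), other good ones (1),
   replacements [X (M d)] footprinting [d] (2), kept ends footprinting [Y d] (3). *)
pose g d := if isbad d then if first d then d else X (M d) else d.
pose f d := if isbad d then if first d then Y d else d else F d.
pose r d : nat := if isbad d then if first d then 3 else 2 else has_epn D d.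
apply: (@Z_sequence_of_rank D g f r) => [d dD|d d' dD dD' dd'].
  rewrite /g /f; case: ifP => [bd|_]; last first.
    by have [/(_ dD)/soleP[_ eFd _] _] := FP d; rewrite e_sym.
  case: ifP => _; first by have [] := YP d bd.
  have [xD _ evx _ _] := YP _ (badM d bd).
  by rewrite e_sym; have [] := bad_nbr optD (badC (MP d bd)) xD evx.
rewrite /g /f /r; case: (boolP (isbad d)) => [bd|gd]; last first.
  have [/(_ dD) sF /(_ dD) epnF] := FP d; have /soleP[_ eFd uniq_F] := sF.
  case: (boolP (isbad d')) => [_|gd'].
    by case: ifP => _ _; case: (has_epn D d).
  rewrite !inE => /orP[/eqP FE|]; last first.
    by rewrite e_sym => /(uniq_F d' dD') d'd; rewrite d'd eqxx in dd'.
  (* Here [F d] is [d'], so [d] has rank 0. If [d'] had rank 0 as well, [F d'] would be [d] and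
     [dd'] a bad edge. *)
  have nd : ~~ has_epn D d by apply/negP => /epnF; rewrite FE dD'.
  rewrite (negPf nd) lt0b; case: (boolP (has_epn D d')) => // nd'.
  have [/(_ dD') sF' _] := FP d'; have /soleP[_ eFd' _] := sF'.
  have FD' : F d' \in D.
    by apply: contraNT nd' => FD'; apply/existsP; exists (F d'); rewrite FD'.
  have FE' : F d' = d by apply: uniq_F; rewrite // FE e_sym.
  case/negP: gd; apply/existsP; exists d'; apply/and4P; split=> //.
    by rewrite -FE'.
  by rewrite -FE.
have [XD YD evX evY [XY eXY]] := YP d bd.
(* Rank 3 is maximal, so every conflict with [Y d] must be refuted: by nonadjacency of [X] and [Y]
   within one bad edge, by [bad_no_edge] between two. *)
case: (boolP (first d)) => fd.
  case: (boolP (isbad d')) => [bd'|gd']; last first.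
    rewrite !inE => /orP[/eqP YE|]; first by rewrite YE dD' in YD.
    rewrite e_sym => /(nbr_bad d d' _ bd YD evY dD').
    by case=> E; [rewrite E bd in gd' | rewrite E badM in gd'].
  case: (boolP (first d')) => fd'.
    rewrite !inE => /orP[/eqP YE|]; first by rewrite YE dD' in YD.
    rewrite e_sym => /(nbr_bad d d' _ bd YD evY dD').
    by case=> E; [rewrite E eqxx in dd' | rewrite E firstM // fd in fd'].
  have [Md'd|Md'd] := eqVneq (M d') d.
    by rewrite Md'd !inE eq_sym (negPf XY) (negPf eXY).
  have bMd' := badM d' bd'; have fMd' : first (M d') by rewrite firstM.
  have Md'Md : M d' != M d by apply: contraTneq fMd' => ->; rewrite firstM ?fd.
  have [XD' _ evX' _ _] := YP _ bMd'.
  have /and4P[/soleP[MD' _ _] _ _ _] := MP d' bd'.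
  rewrite !inE => /orP[/eqP YE|]; last first.
    rewrite e_sym => eYX.
    by have := bad_no_edge optD (MP d bd) (MP _ bMd') Md'd Md'Md YD evY XD' evX';
      rewrite eYX.
  have eYM : e (Y d) (M d') by rewrite YE e_sym.
  by have [E|E] := nbr_bad d _ _ bd YD evY MD' eYM; rewrite E eqxx in Md'd Md'Md.
(* The footprint is [d] itself: in [D] it sees only its mate, of rank 3, and no replacement from
   another bad edge sees it. *)
have /and4P[/soleP[_ _ uniq_d] _ _ _] := MP d bd.
case: (boolP (isbad d')) => [bd'|gd']; last first.
  rewrite !inE (negPf dd') /= e_sym => /(uniq_d d' dD') E.
  by rewrite E badM in gd'.
case: (boolP (first d')) => // fd'.
have [XD' _ evX' _ _] := YP _ (badM d' bd').
rewrite !inE => /orP[/eqP E|eXd]; first by rewrite -E dD in XD'.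
have [E|E] := nbr_bad _ _ _ (badM d' bd') XD' evX' dD eXd.
  by rewrite E firstM // fd' in fd.
by rewrite E MK // eqxx in dd'.
Qed.

End ZGrundy.

Theorem theorem3p2 (T : finType) (e : rel T)
    (e_sym : symmetric e) (e_irr : irreflexive e)
    (no_complete_component :
       forall C : {set T}, C \in components e -> ~~ complete_on e C) :
  gamma_t e <= gamma_grZ e.
Proof.
have noiso := nbhd_neq0 no_complete_component.
have [D optD] := exists_optimal noiso.
have [_ min_t] := gamma_tP noiso; have [tdD _] := optD.
by apply: leq_trans (min_t D tdD) _; apply: card_optimal_le_grZ optD.
Qed.
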